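(* Let $\mathcal H$ be a complex Hilbert space, $T\in\boldsymbol B(\mathcal H)$ a class A operator, and $n,\kappa$ integers greater than $1$. If $X=T^n$ satisfies $X^{*\kappa}X^\kappa=(X^*X)^\kappa$, then $T$ is quasinormal.
   Context: An operator $T\in\boldsymbol B(\mathcal H)$ is of class A if $T^*T\le(T^{*2}T^2)^{1/2}$, and quasinormal if $T(T^*T)=(T^*T)T$. *)

(* Defs.v *)
From mathcomp Require Import all_boot all_order all_algebra.
From mathcomp Require Import reals complex.
Set Implicit Arguments. Unset Strict Implicit. Unset Printing Implicit Defensive.
Import Order.TTheory GRing.Theory Num.Theory.
Local Open Scope ring_scope.

Section Hilbert.
Variables (R : realType) (V : lmodType R[i]).

Definition is_inner_product (ip : V -> V -> R[i]) : Prop :=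
  [/\ forall (a : R[i]) (x y z : V), ip (a *: x + y) z = a * ip x z + ip y z,
      forall x y : V, ip y x = (ip x y)^*,
      forall x : V, 0 <= ip x x
    & forall x : V, ip x x = 0 -> x = 0].

(* Completeness for the norm ||x|| = sqrt <x,x> (stated with squared norms). *)
Definition ip_complete (ip : V -> V -> R[i]) : Prop :=
  forall u : nat -> V,
    (forall e : R[i], 0 < e -> exists N : nat, forall m p : nat,
        (N <= m)%N -> (N <= p)%N -> ip (u m - u p) (u m - u p) < e) ->
    exists l : V, forall e : R[i], 0 < e -> exists N : nat, forall m : nat,
        (N <= m)%N -> ip (u m - l) (u m - l) < e.

Definition is_hilbert_space (ip : V -> V -> R[i]) : Prop :=
  is_inner_product ip /\ ip_complete ip.

Definition bounded_op (ip : V -> V -> R[i]) (T : V -> V) : Prop :=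
  [/\ forall x y : V, T (x + y) = T x + T y,
      forall (a : R[i]) (x : V), T (a *: x) = a *: T x
    & exists M : R[i], forall x : V, ip (T x) (T x) <= M * ip x x].

Definition is_adjoint (ip : V -> V -> R[i]) (T Ts : V -> V) : Prop :=
  forall x y : V, ip (T x) y = ip x (Ts y).

Definition op_le (ip : V -> V -> R[i]) (A B : V -> V) : Prop :=
  forall x : V, 0 <= ip (B x - A x) x.

(* S is the positive square root A^{1/2} of A: S is bounded, self-adjoint,
   positive, and S^2 = A (the positive square root is unique). *)
Definition is_pos_sqrt (ip : V -> V -> R[i]) (A S : V -> V) : Prop :=
  [/\ bounded_op ip S, is_adjoint ip S S,
      (forall x : V, 0 <= ip (S x) x)
    & forall x : V, S (S x) = A x].

Definition class_A (ip : V -> V -> R[i]) (T Ts : V -> V) : Prop :=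
  exists S : V -> V,
    is_pos_sqrt ip (fun x => Ts (Ts (T (T x)))) S /\
    op_le ip (fun x => Ts (T x)) S.

Definition quasinormal (T Ts : V -> V) : Prop :=
  forall x : V, T (Ts (T x)) = Ts (T (T x)).

End Hilbert.

(* Main.v *)
Require Import Defs.
From HB Require Import structures.
From mathcomp Require Import all_boot all_order all_algebra.
From mathcomp Require Import boolp classical_sets reals complex.
From mathcomp Require Import ring lra.
Import Order.TTheory GRing.Theory Num.Theory.
Local Open Scope ring_scope.
Set Implicit Arguments.
Unset Strict Implicit.
Unset Printing Implicit Defensive.

(** Put [P_k = T^*k T^k] and [S = |T^2|]. Class A, [P_1 <= S], conjugated by [T^k]
    gives [P_(k+1) <= Y_k := T^*k S T^k], and [Y_k] is dominated by the geometric
    mean of [P_k] and [P_(k+2)], so [k |-> P_k] is logarithmically convex.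
    Let [A] be the positive n-th root of [P_n]. Then [P_0 = 1] and
    [P_(n kappa) = A^(n kappa)], and a discrete maximum principle (run against
    [(A + eps)^k], with [eps -> 0]) yields [P_k <= A^k] and [Y_k <= A^(k+1)] for
    all [k] in between. Since [P_n = A^n] at an interior index, the equality case
    propagates downwards: [P_(k+1) = A^(k+1)] forces [S T^k = T^k A] and
    [P_k = A^k]. At [k = 0, 1] this reads [S = A], [T^* T = A] and [A T = T A].
    Only real parts of inner products matter, so the argument is carried out in
    the underlying real Hilbert space. *)

(** * Positive semidefinite symmetric forms on a real vector space *)

Section Forms.
Variables (R : realType) (V : lmodType R).
Implicit Types (b g f : V -> V -> R) (x y z u v : V).

(** Semidefinite only: [Y k] and the differences of forms studied below may have a kernel. *)
Record psform b : Prop := PSForm {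
  formDl : forall x y z, b (x + y) z = b x z + b y z;
  formZl : forall a x z, b (a *: x) z = a * b x z;
  formC : forall x y, b x y = b y x;
  form_ge0 : forall x, 0 <= b x x }.

Section Theory.
Variables (b : V -> V -> R) (hb : psform b).

Lemma formDr x y z : b x (y + z) = b x y + b x z.
Proof. by rewrite formC // formDl // ![b _ x]formC. Qed.

Lemma formZr a x y : b x (a *: y) = a * b x y.
Proof. by rewrite formC // formZl // [b y x]formC. Qed.

Lemma formNl x y : b (- x) y = - b x y.
Proof. by rewrite -scaleN1r formZl // mulN1r. Qed.

Lemma formNr x y : b x (- y) = - b x y.
Proof. by rewrite -scaleN1r formZr // mulN1r. Qed.

Lemma formBl x y z : b (x - y) z = b x z - b y z.
Proof. by rewrite formDl // formNl. Qed.

Lemma formBr x y z : b x (y - z) = b x y - b x z.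
Proof. by rewrite formDr // formNr. Qed.

Lemma form0l x : b 0 x = 0.
Proof. by rewrite -(scale0r x) formZl // mul0r. Qed.

Lemma formDD x y : b (x + y) (x + y) = b x x + 2 * b x y + b y y.
Proof. by rewrite formDl // !formDr // (formC hb y x); ring. Qed.

Lemma formBB x y : b (x - y) (x - y) = b x x - 2 * b x y + b y y.
Proof. by rewrite formBl // !formBr // (formC hb y x); ring. Qed.

Lemma formZZ a x : b (a *: x) (a *: x) = a ^+ 2 * b x x.
Proof. by rewrite formZl // formZr // mulrA. Qed.

Lemma form_CauchySchwarz x y : b x y ^+ 2 <= b x x * b y y.
Proof.
have h1 := form_ge0 hb (b x x *: y - b x y *: x).
have h2 := form_ge0 hb (b y y *: x - b x y *: y).
have h3 := form_ge0 hb (x + y); have h4 := form_ge0 hb (x - y).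
move: h1 h2 h3 h4; rewrite formDD !formBB !formZZ !formZl // !formZr //.
rewrite (formC hb y x) => h1 h2 h3 h4.
have := form_ge0 hb x; rewrite le_eqVlt => /orP[/eqP x0|x0]; last first.
  rewrite -subr_ge0 -(pmulr_rge0 _ x0); apply: le_trans h1 _; nra.
have := form_ge0 hb y; rewrite le_eqVlt => /orP[/eqP y0|y0]; last first.
  rewrite -subr_ge0 -(pmulr_rge0 _ y0); apply: le_trans h2 _; nra.
have -> : b x y = 0 by lra.
by rewrite expr0n mulr_ge0 ?form_ge0.
Qed.

Lemma form_add2_le x y : b (x + y) (x + y) <= 2 * (b x x + b y y).
Proof. by rewrite formDD; have := form_ge0 hb (x - y); rewrite formBB; lra. Qed.

End Theory.

(** The infimum of the admissible constants is itself admissible: where [g u] vanishes the bound by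
    [K] already gives [f u <= 0], and elsewhere one divides by [g u]. *)
Lemma least_bound (f g : V -> R) (K : R) :
  (forall u, 0 <= f u) -> (forall u, 0 <= g u) -> 0 <= K ->
  (forall u, f u <= K * g u) ->
  exists mu : R, [/\ 0 <= mu, forall u, f u <= mu * g u &
    forall m, 0 <= m -> (forall u, f u <= m * g u) -> mu <= m].
Proof.
move=> f0 g0 K0 hK.
pose M : set R := [set m | 0 <= m /\ forall u, f u <= m * g u]%classic.
have lbM : lbound M 0 by move=> m [].
exists (inf M); split.
- by apply: lb_le_inf; [exists K | exact: lbM].
- move=> u; have := g0 u; rewrite le_eqVlt => /orP[/eqP gu|gu].
    by have := hK u; rewrite -gu !mulr0.
  rewrite -ler_pdivrMr //; apply: lb_le_inf; first by exists K.
  by move=> m [m0 hm]; rewrite ler_pdivrMr.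
- by move=> m m0 hm; apply: ge_inf; [exists 0 | split].
Qed.

(* Take the least [mu] with [y <= mu g]. A vector [u] for which [mu g - y] is
   nearly null makes [(mu g - y)(u, Q u)] small by Cauchy-Schwarz, so the
   off-diagonal bound at [u] forces [mu <= e]. *)
Lemma form_bound (y g N : V -> V -> R) (Q : V -> V) (eta K e : R) :
  psform y -> psform g -> (forall u, 0 <= N u u) -> 0 < eta -> 0 <= e ->
  (forall u, y u u <= K * N u u) ->
  (forall u, eta * N u u <= g u u) ->
  (forall u, g u u <= K * N u u) ->
  (forall u, g (Q u) (Q u) <= K * N u u) ->
  (forall u, eta * N u u <= g u (Q u)) ->
  (forall u, y u (Q u) <= e * g u (Q u)) ->
  forall u, y u u <= e * g u u.
Proof.
move=> hy hg N0 eta0 e0 yK geta gK gQ gQeta hyQ.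
wlog K0 : K yK gK gQ / 0 < K.
  have hM v : K * N v v <= (`|K| + 1) * N v v.
    by rewrite ler_wpM2r // (le_trans (ler_norm _)) // lerDl.
  move=> hw; apply: (hw (`|K| + 1)); last by rewrite ltr_wpDl.
  - by move=> v; apply: le_trans (hM v).
  - by move=> v; apply: le_trans (hM v).
  - by move=> v; apply: le_trans (hM v).
have [|||u|mu [mu0 hmu minmu] u] :=
  @least_bound (fun u => y u u) (fun u => g u u) (K / eta).
- by move=> u; exact: form_ge0.
- by move=> u; exact: form_ge0.
- by rewrite divr_ge0 // ltW.
- apply: le_trans (yK u) _; rewrite -mulrA ler_wpM2l ?(ltW K0) //.
  by rewrite ler_pdivlMl.
suff le_mu : mu <= e.
  by apply: le_trans (hmu u) _; rewrite ler_wpM2r // form_ge0.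
rewrite leNgt; apply/negP => lt_mu.
have mup : 0 < mu by apply: le_lt_trans e0 lt_mu.
pose r := (mu - e) ^+ 2 * eta ^+ 2.
have r0 : 0 < r by rewrite mulr_gt0 // exprn_gt0 // subr_gt0.
(* Small enough for [d * (mu * K ^+ 2) < r], which contradicts the Cauchy-Schwarz inequality for [D]
   at [w] and [Q w]. The minimum with [mu] keeps [mu - d] nonnegative, hence a competitor in
   [minmu]. *)
pose d := Num.min mu (r / (2 * (mu * K ^+ 2))).
have L0 : 0 < 2 * (mu * K ^+ 2) by rewrite !mulr_gt0.
have d0 : 0 < d by rewrite lt_min mup divr_gt0.
have dmu : d <= mu by rewrite ge_min lexx.
have dr : d * (mu * K ^+ 2) < r.
  have : d <= r / (2 * (mu * K ^+ 2)) by rewrite ge_min lexx orbT.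
  by rewrite ler_pdivlMr //; nra.
have [w hw] : exists w, (mu - d) * g w w < y w w.
  apply: contrapT => /forallNP hn.
  have := minmu (mu - d); rewrite subr_ge0 => /(_ dmu).
  suff hm : forall w, y w w <= (mu - d) * g w w by move=> /(_ hm); lra.
  by move=> w; rewrite leNgt; apply/negP/hn.
pose D x1 x2 := mu * g x1 x2 - y x1 x2.
have hD : psform D.
  split=> [x1 x2 x3|a x1 x2|x1 x2|x1]; rewrite /D.
  - by rewrite !formDl //; ring.
  - by rewrite !formZl //; ring.
  - by rewrite (formC hg) (formC hy).
  - by rewrite subr_ge0.
have := form_CauchySchwarz hD w (Q w).
have N1 : 0 < N w w.
  rewrite lt_def N0 andbT; apply/eqP => Nw.
  have := yK w; have := form_ge0 hg w; have := geta w; have := gK w.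
  by rewrite Nw !mulr0; nra.
have hDw : D w w <= d * (K * N w w).
  apply: le_trans (_ : d * g w w <= _); first by rewrite /D; lra.
  by rewrite ler_wpM2l // ltW.
have hDQ : D (Q w) (Q w) <= mu * (K * N w w).
  have h1 := form_ge0 hy (Q w).
  apply: le_trans (_ : mu * g (Q w) (Q w) <= _); first by rewrite /D; lra.
  by rewrite ler_wpM2l.
have hDwQ : (mu - e) * (eta * N w w) <= D w (Q w).
  apply: le_trans (_ : (mu - e) * g w (Q w) <= _).
    by rewrite ler_wpM2l // subr_ge0 ltW.
  by have := hyQ w; rewrite /D; lra.
have lhs : ((mu - e) * (eta * N w w)) ^+ 2 <= D w (Q w) ^+ 2.
  by rewrite lerXn2r // ?nnegrE ?(le_trans _ hDwQ) // !mulr_ge0 ?subr_ge0 ?ltW.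
have rhs : D w w * D (Q w) (Q w) <= (d * (K * N w w)) * (mu * (K * N w w)).
  by apply: ler_pM => //; exact: form_ge0.
move=> CS; have := le_trans (le_trans lhs CS) rhs.
rewrite leNgt => /negP; apply.
have -> : d * (K * N w w) * (mu * (K * N w w)) = d * (mu * K ^+ 2) * N w w ^+ 2.
  by ring.
have -> : ((mu - e) * (eta * N w w)) ^+ 2 = r * N w w ^+ 2 by rewrite /r; ring.
by rewrite ltr_pM2r // exprn_gt0.
Qed.

(** At the first index where [c] exceeds 1 the sequence has just increased, and logarithmic
    convexity then keeps it from decreasing up to [N], where it is at most 1. *)
Lemma discrete_max_principle (c : nat -> R) (N : nat) :
  (forall k, 0 <= c k) -> c 0%N <= 1 -> c N <= 1 ->
  (forall k, (k.+2 <= N)%N -> c k.+1 ^+ 2 <= c k * c k.+2) ->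
  forall k, (k <= N)%N -> c k <= 1.
Proof.
move=> c_ge0 c0 cN cvx k kN; rewrite leNgt; apply/negP => ck.
have ex : exists k, 1 < c k by exists k.
case: (ex_minnP ex) => -[|j] cj minj; first by move: cj; rewrite ltNge c0.
have cj1 : c j <= 1 by rewrite leNgt; apply/negP => /minj; rewrite ltnn.
have jN : (j.+1 <= N)%N by apply: leq_trans (minj _ ck) kN.
have grow i : ((j + i).+1 <= N)%N -> c (j + i)%N <= c (j + i).+1 /\ 1 < c (j + i).+1.
  elim: i => [|i IH] hi; first by rewrite addn0; split => //; lra.
  rewrite addnS in hi *; have [h1 h2] := IH (ltnW hi).
  suff h3 : c (j + i).+1 <= c (j + i).+2 by split => //; exact: lt_le_trans h3.
  have h0 := cvx _ hi; have h4 : 0 < c (j + i).+1 by lra.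
  rewrite -(ler_pM2l h4) -expr2; apply: le_trans h0 _.
  by rewrite ler_wpM2r.
have [] := grow (N - j.+1)%N; first by rewrite -addSn subnKC.
by rewrite -addSn subnKC // => _; rewrite ltNge cN.
Qed.

End Forms.

(** * Polynomials in a linear operator *)

Section OperatorPolynomials.
Variables (R : realType) (V : lmodType R) (B : {linear V -> V}).
Implicit Types (p q : {poly R}) (x y : V).

Definition opeval p x : V := \sum_(i < size p) p`_i *: iter i B x.

Lemma opeval_widen n p x : (size p <= n)%N ->
  opeval p x = \sum_(i < n) p`_i *: iter i B x.
Proof.
move=> hn; rewrite /opeval (big_ord_widen n (fun i => p`_i *: iter i B x)) //.
rewrite big_mkcond; apply: eq_bigr => i _; case: ltnP => // hi.
by rewrite nth_default // scale0r.
Qed.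

Lemma iter_linear n : linear (iter n B).
Proof. by elim: n => [|n IH] a x y //=; rewrite IH linearP. Qed.

Lemma opeval_linear p : linear (opeval p).
Proof.
move=> a x y; rewrite /opeval scaler_sumr -big_split; apply: eq_bigr => i _ /=.
by rewrite iter_linear scalerDr !scalerA mulrC.
Qed.

HB.instance Definition _ p :=
  GRing.isLinear.Build R V V *:%R (opeval p) (opeval_linear p).

Lemma opevalD p q x : opeval (p + q) x = opeval p x + opeval q x.
Proof.
rewrite !(@opeval_widen (maxn (size p) (size q))) //;
  rewrite ?size_polyD ?leq_max ?leqnn ?orbT //.
by rewrite -big_split; apply: eq_bigr => i _; rewrite coefD scalerDl.
Qed.

Lemma opevalZ a p x : opeval (a *: p) x = a *: opeval p x.
Proof.
rewrite (@opeval_widen (size p)) ?size_scale_leq // /opeval scaler_sumr.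
by apply: eq_bigr => i _; rewrite coefZ scalerA.
Qed.

Lemma opevalN p x : opeval (- p) x = - opeval p x.
Proof. by rewrite -[- p]scaleN1r opevalZ scaleN1r. Qed.

Lemma opevalB p q x : opeval (p - q) x = opeval p x - opeval q x.
Proof. by rewrite opevalD opevalN. Qed.

Lemma opevalC a x : opeval a%:P x = a *: x.
Proof.
by rewrite (@opeval_widen 1%N) ?size_polyC_leq1 // big_ord1 coefC /=.
Qed.

Lemma opeval1 x : opeval 1 x = x.
Proof. by rewrite -[1]/(1%:P) opevalC scale1r. Qed.

Lemma opevalMX p x : opeval (p * 'X) x = B (opeval p x).
Proof.
rewrite (@opeval_widen (size p).+1); last first.
  by rewrite (leq_trans (size_polyMleq _ _)) // size_polyX addn2.
rewrite big_ord_recl coefMX /= scale0r add0r /opeval linear_sum.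
by apply: eq_bigr => i _; rewrite coefMX /= linearZ.
Qed.

Lemma opevalM p q x : opeval (p * q) x = opeval p (opeval q x).
Proof.
elim/poly_ind: p => [|p c IH]; first by rewrite mul0r -polyC0 !opevalC !scale0r.
by rewrite mulrDl mulrAC !opevalD !opevalMX IH mul_polyC opevalZ opevalC.
Qed.

Lemma opevalX x : opeval 'X x = B x.
Proof. by rewrite -['X]mul1r opevalMX opeval1. Qed.

Lemma opevalXn n x : opeval 'X^n x = iter n B x.
Proof. by elim: n => [|n IH]; rewrite ?expr0 ?opeval1 // exprSr opevalMX IH. Qed.

Lemma opeval_commute p q x : opeval p (opeval q x) = opeval q (opeval p x).
Proof. by rewrite -!opevalM mulrC. Qed.

End OperatorPolynomials.

(** * Positivity of polynomials in a bounded positive operator *)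

Section PositiveOperators.
Variables (R : realType) (V : lmodType R) (ip : V -> V -> R).
Hypothesis hip : psform ip.
Implicit Types (x y : V).

Definition opsym (f : V -> V) := forall x y, ip (f x) y = ip x (f y).
Definition oppos (f : V -> V) := forall x, 0 <= ip (f x) x.
Definition opbounded (f : V -> V) :=
  exists M, forall x, ip (f x) (f x) <= M * ip x x.

Lemma opbounded_ge0 (f : V -> V) : opbounded f ->
  exists2 M, 0 <= M & forall x, ip (f x) (f x) <= M * ip x x.
Proof.
move=> [M hM]; exists `|M| => // x; apply: le_trans (hM x) _.
by rewrite ler_wpM2r ?ler_norm ?form_ge0.
Qed.

Section Calculus.
Variable B : {linear V -> V}.
Hypotheses (Bsym : opsym B) (Bbnd : opbounded B) (Bpos : oppos B).
Implicit Types (p q r : {poly R}).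

Lemma opeval_sym p : opsym (opeval B p).
Proof.
elim/poly_ind: p => [|p c IH] x y.
  by rewrite -polyC0 !opevalC !scale0r form0l // formC // form0l.
by rewrite !opevalD !opevalMX !opevalC formDl // formDr // formZl // formZr //
  Bsym IH -opevalX opeval_commute opevalX.
Qed.

Lemma opeval_bounded p : opbounded (opeval B p).
Proof.
have [M M0 hM] := opbounded_ge0 Bbnd.
elim/poly_ind: p => [|p c [L hL]].
  by exists 0 => x; rewrite -polyC0 !opevalC !scale0r form0l // mul0r.
exists (2 * (M * L + c ^+ 2)) => x.
rewrite !opevalD !opevalMX !opevalC.
apply: le_trans (form_add2_le hip _ _) _.
rewrite formZZ //; have := le_trans (hM _) (ler_wpM2l M0 (hL x)); lra.
Qed.

(** Positivity concerns the operator [p(B)], not the coefficients or the values of [p]. *)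
Definition ppos p := oppos (opeval B p).

Lemma ppos_sq p q : ppos q -> ppos (p ^+ 2 * q).
Proof.
move=> hq x; rewrite -[_ * _]mulrA opevalM mulrC opevalM.
by rewrite opeval_sym.
Qed.

Lemma pposD p q : ppos p -> ppos q -> ppos (p + q).
Proof. by move=> hp hq x; rewrite opevalD formDl // addr_ge0. Qed.

Lemma pposC a : 0 <= a -> ppos a%:P.
Proof. by move=> a0 x; rewrite opevalC formZl // mulr_ge0 // form_ge0. Qed.

Lemma pposZ a p : 0 <= a -> ppos p -> ppos (a *: p).
Proof. by move=> a0 hp x; rewrite opevalZ formZl // mulr_ge0. Qed.

Lemma pposX : ppos 'X.
Proof. by move=> x; rewrite opevalX. Qed.

Lemma ppos_ub p : exists2 c, 0 < c & ppos (c%:P - p).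
Proof.
have [M M0 hM] := opbounded_ge0 (opeval_bounded p).
exists (M + 1); first by rewrite ltr_wpDl.
move=> x; rewrite opevalB opevalC formBl // formZl // subr_ge0.
have := hM x; have := form_ge0 hip (opeval B p x - x).
have := form_ge0 hip x; rewrite formBB //; nra.
Qed.

Fixpoint riesz p n : {poly R} :=
  if n is n'.+1 then riesz p n' - riesz p n' ^+ 2 else p.

(** Positivity of general products is not yet available, so each bound is rewritten as a sum of
    positive terms whose only products carry a square factor. *)
Lemma riesz_bounds p n : ppos p -> ppos (1 - p) ->
  ppos (riesz p n) /\ ppos (1 - riesz p n).
Proof.
move=> p0 p1; elim: n => [|n [h0 h1]] //=; set r := riesz p n in h0 h1 *; split.
  have -> : r - r ^+ 2 = r ^+ 2 * (1 - r) + (1 - r) ^+ 2 * r by ring.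
  by apply: pposD; exact: ppos_sq.
have -> : 1 - (r - r ^+ 2) = (1 - r) + r ^+ 2 * 1 by ring.
by apply: pposD => //; apply: ppos_sq; rewrite -polyC1; apply: pposC.
Qed.

Lemma riesz_sum p n : p - riesz p n = \sum_(i < n) riesz p i ^+ 2.
Proof.
elim: n => [|n IH]; first by rewrite big_ord0 subrr.
by rewrite big_ord_recr -IH /=; ring.
Qed.

Lemma opeval_sum n (F : 'I_n -> {poly R}) x :
  opeval B (\sum_(i < n) F i) x = \sum_(i < n) opeval B (F i) x.
Proof.
elim: n F => [|n IH] F; first by rewrite !big_ord0 -polyC0 opevalC scale0r.
by rewrite !big_ord_recr opevalD IH.
Qed.

Lemma form_suml n (F : 'I_n -> V) x :
  ip (\sum_(i < n) F i) x = \sum_(i < n) ip (F i) x.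
Proof.
elim: n F => [|n IH] F; first by rewrite !big_ord0 form0l.
by rewrite !big_ord_recr formDl // IH.
Qed.

(* Riesz: with [0 <= q <= 1], [q] is the strong sum of the squares of
   [r_{n+1} = r_n - r_n^2], [r_0 = q], so [p q] is a sum of [r_n p r_n]. *)
Lemma pposM p q : ppos p -> ppos q -> ppos (p * q).
Proof.
wlog q1 : q / ppos (1 - q) => [hw p0 q0|p0 q0 x].
  have [c c0 hc] := ppos_ub q.
  have -> : p * q = c *: (p * (c^-1 *: q)).
    by rewrite -scalerAr scalerA divff ?scale1r // gt_eqF.
  apply: pposZ; first exact: ltW.
  apply: hw => //; last by apply: pposZ => //; rewrite invr_ge0 ltW.
  have -> : 1 - c^-1 *: q = c^-1 *: (c%:P - q).
    by rewrite scalerBr -[_ *: c%:P]mul_polyC -polyCM mulVf // gt_eqF.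
  by apply: pposZ => //; rewrite invr_ge0 ltW.
(* No limit is taken. If [t < 0], then [<w n, a> <= t] keeps every [w n] away from 0, while the sum
   of the [||w i||^2] stays below [<q x, x>]; a large [n] gives a contradiction. *)
rewrite leNgt; apply/negP => hneg.
set t := ip _ _ in hneg.
pose w n := opeval B (riesz q n) x; pose a := opeval B p x.
have hlow n : t ^+ 2 <= ip (w n) (w n) * ip a a.
  apply: le_trans (form_CauchySchwarz hip _ _).
  have : ip (w n) a <= t.
    have -> : t = ip (opeval B (p * (q - riesz q n)) x) x + ip (w n) a.
      have e : ip (opeval B (p * riesz q n) x) x = ip (w n) a.
        by rewrite opevalM opeval_sym.
      by rewrite mulrBr opevalB formBl // e subrK.
    rewrite lerDr riesz_sum mulr_sumr opeval_sum form_suml sumr_ge0 // => i _.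
    by rewrite mulrC; apply: ppos_sq.
  by nra.
have hup n : \sum_(i < n) ip (w i) (w i) <= ip (opeval B q x) x.
  have [h _] := riesz_bounds n q0 q1.
  have -> : \sum_(i < n) ip (w i) (w i) = ip (opeval B (q - riesz q n) x) x.
    rewrite riesz_sum opeval_sum form_suml; apply: eq_bigr => i _.
    by rewrite expr2 opevalM [RHS]opeval_sym.
  by rewrite opevalB formBl // gerBl.
have t2 : 0 < t ^+ 2 by rewrite exprn_even_gt0 //= lt_eqF.
have hall n : n%:R * t ^+ 2 <= ip (opeval B q x) x * ip a a.
  apply: le_trans (_ : (\sum_(i < n) ip (w i) (w i)) * ip a a <= _); last first.
    by rewrite ler_wpM2r // form_ge0.
  have -> : n%:R * t ^+ 2 = \sum_(i < n) t ^+ 2.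
    by rewrite sumr_const card_ord mulr_natl.
  by rewrite mulr_suml; apply: ler_sum => i _; exact: hlow.
have /archi_boundP : 0 <= ip (opeval B q x) x * ip a a / t ^+ 2.
  by apply: divr_ge0 (ltW t2); apply: mulr_ge0; [exact: q0 | exact: form_ge0].
by rewrite ltr_pdivrMr // ltNge hall.
Qed.

Lemma ppos1 : ppos 1.
Proof. by rewrite -polyC1; apply: pposC. Qed.

Lemma pposXn p n : ppos p -> ppos (p ^+ n).
Proof.
by move=> hp; elim: n => [|n IH]; rewrite ?expr0 ?exprS; [exact: ppos1|exact: pposM].
Qed.

End Calculus.
End PositiveOperators.

(** * Norm convergence of sequences of vectors *)

Section StrongConvergence.
Variables (R : realType) (V : lmodType R) (ip : V -> V -> R).
Hypothesis hip : psform ip.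
Implicit Types (u v : nat -> V) (x y l : V).

Definition ip_cvg u l := forall e, 0 < e ->
  exists N, forall m, (N <= m)%N -> ip (u m - l) (u m - l) < e.

Definition ip_cauchy u := forall e, 0 < e ->
  exists N, forall m p, (N <= m)%N -> (N <= p)%N ->
  ip (u m - u p) (u m - u p) < e.

Lemma ip_cvg_cst l : ip_cvg (fun=> l) l.
Proof. by move=> e e0; exists 0%N => m _; rewrite subrr form0l. Qed.

Lemma ip_cvgD u v l l' : ip_cvg u l -> ip_cvg v l' ->
  ip_cvg (fun n => u n + v n) (l + l').
Proof.
move=> hu hv e e0; have e4 : 0 < e / 4 by lra.
have [N1 h1] := hu _ e4; have [N2 h2] := hv _ e4.
exists (maxn N1 N2) => m; rewrite geq_max => /andP[/h1 + /h2].
have := form_add2_le hip (u m - l) (v m - l').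
by rewrite opprD addrACA; lra.
Qed.

(** Split [f n (u n) - l'] as [f n (u n - l) + (f n l - l')]; contractivity uniform in [n] controls
    the first term. This carries powers of operators to a strong limit. *)
Lemma ip_cvg_contraction (f : nat -> {linear V -> V}) u l l' :
  (forall n x, ip (f n x) (f n x) <= ip x x) ->
  ip_cvg u l -> ip_cvg (f^~ l) l' -> ip_cvg (fun n => f n (u n)) l'.
Proof.
move=> hf hu hl e e0; have e4 : 0 < e / 4 by lra.
have [N1 h1] := hu _ e4; have [N2 h2] := hl _ e4.
exists (maxn N1 N2) => m; rewrite geq_max => /andP[/h1 + /h2].
have := form_add2_le hip (f m (u m - l)) (f m l - l').
have := hf m (u m - l).
have -> : f m (u m - l) + (f m l - l') = f m (u m) - l'.
  by rewrite linearB /= addrA subrK.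
by lra.
Qed.

Lemma ip_cvgZ a u l : ip_cvg u l -> ip_cvg (fun n => a *: u n) (a *: l).
Proof.
move=> hu e e0; have a0 : 0 < a ^+ 2 + 1 by rewrite ltr_wpDl ?sqr_ge0.
have [N h] := hu _ (divr_gt0 e0 a0); exists N => m /h.
rewrite -scalerBr formZZ // ltr_pdivlMr //.
by have := form_ge0 hip (u m - l); lra.
Qed.

Lemma ip_cvg_shift u l : ip_cvg u l -> ip_cvg (fun n => u n.+1) l.
Proof.
move=> hu e /hu[N h]; exists N => m hm; apply: h; exact: leq_trans hm _.
Qed.

(** The two test vectors and the constant [c] let one statement yield uniqueness of limits and the
    symmetry, positivity and boundedness of a limit operator. *)
Lemma ip_cvg_le u v l l' x y c : ip_cvg u l -> ip_cvg v l' ->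
  (forall n, ip (u n) y <= ip (v n) x + c) -> ip l y <= ip l' x + c.
Proof.
move=> hu hv huv; rewrite leNgt; apply/negP => hlt.
pose g := ip l y - (ip l' x + c).
have g0 : 0 < g by rewrite subr_gt0.
(* [K] dominates both [||x||^2] and [||y||^2]; at accuracy [(g / 2)^2 / K] each pairing is off by
   less than [g / 2]. *)
pose K := ip x x + ip y y + 1.
have K0 : 0 < K by rewrite ltr_wpDl // addr_ge0 // form_ge0.
have eps0 : 0 < (g / 2) ^+ 2 / K by rewrite divr_gt0 // exprn_gt0 // divr_gt0.
have [N1 h1] := hu _ eps0; have [N2 h2] := hv _ eps0.
pose m := maxn N1 N2.
have := h1 m (leq_maxl _ _); have := h2 m (leq_maxr _ _).
rewrite !ltr_pdivlMr // => k2 k1.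
have small (w z : V) : ip z z <= K -> ip w w * K < (g / 2) ^+ 2 ->
    ip w z < g / 2 /\ - (g / 2) < ip w z.
  move=> hz hw; have CS := form_CauchySchwarz hip w z.
  have := ler_wpM2l (form_ge0 hip w) hz.
  by split; nra.
have xK : ip x x <= K by rewrite /K -addrA lerDl addr_ge0 // form_ge0.
have yK : ip y y <= K by have := form_ge0 hip x; rewrite /K; lra.
have [_] := small _ _ yK k1; have [+ _] := small _ _ xK k2.
rewrite !formBl //; have := huv m; rewrite /g; lra.
Qed.

Hypothesis ip_def : forall x, ip x x = 0 -> x = 0.

Lemma ip_cvg_unique u l l' : ip_cvg u l -> ip_cvg u l' -> l = l'.
Proof.
move=> h h'; apply/eqP; rewrite -subr_eq0; apply/eqP/ip_def.
have hle y : ip l y <= ip l' y.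
  by rewrite -[leRHS]addr0; apply: (ip_cvg_le h h') => n; rewrite addr0.
have := hle (l - l'); have := hle (- (l - l')).
by rewrite !formNr // formBl //; lra.
Qed.

End StrongConvergence.

(** * Roots of positive operators *)

Section Roots.
Variables (R : realType) (V : lmodType R) (ip : V -> V -> R).
Hypotheses (hip : psform ip) (ip_def : forall x, ip x x = 0 -> x = 0).
Hypothesis ip_compl : forall u, ip_cauchy ip u -> exists l, ip_cvg ip u l.

(* Newton's iteration for [z ^ n = B], with the derivative frozen at its
   value [n] at [z = 1] so that it stays polynomial in [B]. *)
Fixpoint root_iter (n k : nat) : {poly R} :=
  if k is k'.+1 then
    root_iter n k' - n%:R^-1%:P * (root_iter n k' ^+ n - 'X)
  else 1.

Section Contraction.
Variable B : {linear V -> V}.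
Hypotheses (Bsym : opsym ip B) (Bbnd : opbounded ip B) (Bpos : oppos ip B).
Local Notation pos := (ppos ip B).

(** This is positivity of [p (1 - p)]. It bounds a norm by a quadratic form, so that monotone scalar
    convergence becomes norm convergence. *)
Lemma contraction_sq p x : pos p -> pos (1 - p) ->
  ip (opeval B p x) (opeval B p x) <= ip (opeval B p x) x.
Proof.
move=> p0 p1; rewrite -subr_ge0.
have := pposM hip Bsym Bbnd p0 p1 x; rewrite mulrBr mulr1.
by rewrite opevalB formBl // opevalM (opeval_sym hip Bsym p (opeval B p x)).
Qed.

Lemma contraction_le p x : pos p -> pos (1 - p) ->
  ip (opeval B p x) (opeval B p x) <= ip x x.
Proof.
move=> p0 p1; apply: le_trans (contraction_sq _ p0 p1) _.
by have := p1 x; rewrite opevalB opeval1 formBl // subr_ge0.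
Qed.

Lemma ppos_1BM p q : pos p -> pos (1 - p) -> pos (1 - q) -> pos (1 - p * q).
Proof.
move=> p0 p1 q1; have -> : 1 - p * q = (1 - p) + p * (1 - q) by ring.
by apply: pposD => //; exact: pposM.
Qed.

Lemma ppos_1BXn p n : pos p -> pos (1 - p) -> pos (1 - p ^+ n).
Proof.
move=> p0 p1; elim: n => [|n IH]; last by rewrite exprS; exact: ppos_1BM.
by rewrite expr0 subrr -polyC0; exact: pposC.
Qed.

Lemma ppos_sum n (F : 'I_n -> {poly R}) : (forall i, pos (F i)) ->
  pos (\sum_(i < n) F i).
Proof.
move=> hF; elim/big_ind: _ => //; last by move=> p q; exact: pposD.
by rewrite -polyC0; exact: pposC.
Qed.

Hypothesis B1 : pos (1 - 'X).

(** The third bound makes every correction positive, so the iterates decrease; the first two allow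
    products and powers of iterates to be compared with 1. *)
Lemma root_iter_bounds n k : let z := root_iter n.+1 k in
  [/\ pos z, pos (1 - z) & pos (z ^+ n.+1 - 'X)].
Proof.
have X0 : pos 'X := pposX Bpos.
pose c : {poly R} := n.+1%:R^-1%:P.
have c0 : pos c by apply: pposC => //; rewrite invr_ge0 ler0n.
have c1 : pos (1 - c).
  rewrite -polyC1 -polyCB; apply: pposC => //.
  by rewrite subr_ge0 invf_le1 ?ltr0n // ler1n.
have cn : c * n.+1%:R = 1.
  by rewrite -polyC_natr -polyCM mulVf // pnatr_eq0.
elim: k => [|k [z0 z1 d0]] /=.
  rewrite expr1n; split => //; first exact: ppos1.
  by rewrite subrr -polyC0; exact: pposC.
rewrite -/c; set z := root_iter _ k in z0 z1 d0 *.
set d := z ^+ n.+1 - 'X in d0 *; set z' := z - c * d.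
have z'0 : pos z'.
  have -> : z' = z * ((1 - c) + c * (1 - z ^+ n)) + c * 'X.
    by rewrite /z' /d exprS; ring.
  apply: pposD => //; last exact: pposM.
  apply: pposM => //; apply: pposD => //; apply: pposM => //.
  exact: ppos_1BXn.
have z'1 : pos (1 - z').
  have -> : 1 - z' = (1 - z) + c * d by rewrite /z'; ring.
  by apply: pposD => //; exact: pposM.
split => //.
(* Factoring [z^(n+1) - z'^(n+1)] through [z - z' = c d], with [c (n + 1) = 1], leaves [d] times an
   average of terms [1 - z^i z'^j], each of them positive. *)
have -> : z' ^+ n.+1 - 'X =
    d * (c * \sum_(i < n.+1) (1 - z ^+ (n.+1.-1 - i) * z' ^+ i)).
  rewrite sumrB sumr_const card_ord mulrBr cn.
  have := subrXX z z' n.+1; have -> : z - z' = c * d by rewrite /z'; ring.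
  set S := \sum_(i < _) _ => e.
  have -> : z' ^+ n.+1 = z ^+ n.+1 - c * d * S by rewrite -e; ring.
  by rewrite /d; ring.
apply: pposM => //; apply: pposM => //; apply: ppos_sum => i.
apply: ppos_1BM; [exact: pposXn | exact: ppos_1BXn | exact: ppos_1BXn].
Qed.

Lemma root_iter_decr n m k : (m <= k)%N ->
  pos (root_iter n.+1 m - root_iter n.+1 k).
Proof.
move=> /subnK <-; elim: (k - m)%N => [|j IH].
  by rewrite add0n subrr -polyC0; exact: pposC.
rewrite addSn /=; set z := root_iter _ (j + m) in IH *.
set w := root_iter _ m in IH *; set c := _%:P; set d := z ^+ _ - _.
have -> : w - (z - c * d) = (w - z) + c * d by ring.
have [_ _ d0] := root_iter_bounds n (j + m).
apply: pposD => //; apply: pposM => //; apply: pposC => //.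
by rewrite invr_ge0 ler0n.
Qed.

(** The scalars [a k] decrease and are bounded below, so they accumulate at their infimum;
    [contraction_sq], applied to differences of iterates, turns this into a norm estimate. *)
Lemma root_iter_cauchy n x :
  ip_cauchy ip (fun k => opeval B (root_iter n.+1 k) x).
Proof.
pose a k := ip (opeval B (root_iter n.+1 k) x) x.
have a_decr m k : (m <= k)%N -> a k <= a m.
  move=> /(root_iter_decr n) /(_ x).
  by rewrite opevalB formBl // subr_ge0.
pose E : set R := [set r | exists k, r = a k]%classic.
have infE : has_inf E.
  split; first by exists (a 0%N), 0%N.
  by exists 0 => _ [k ->]; have [h _ _] := root_iter_bounds n k; exact: h.
move=> e e0; have [_ [N ->] hN] := inf_adherent e0 infE.
have key m p : (N <= m)%N -> (m <= p)%N ->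
    ip (opeval B (root_iter n.+1 m - root_iter n.+1 p) x)
       (opeval B (root_iter n.+1 m - root_iter n.+1 p) x) < e.
  move=> Nm mp; apply: le_lt_trans (contraction_sq _ _ _) _.
  - exact: root_iter_decr.
  - have [_ h1 _] := root_iter_bounds n m; have [h2 _ _] := root_iter_bounds n p.
    by rewrite opprB addrCA addrC; exact: pposD.
  rewrite opevalB formBl // -/(a m) -/(a p).
  have := a_decr _ _ Nm; have : inf E <= a p by apply: ge_inf; [exact: infE.2 | exists p].
  by lra.
exists N => m p Nm Np; case: (leqP m p) => [|/ltnW] mp.
  by rewrite -opevalB; exact: key.
by rewrite -opprB formNl // formNr // opprK -opevalB; exact: key.
Qed.

Lemma contraction_root n : exists A : {linear V -> V},
  [/\ opsym ip A, oppos ip A, opbounded ip A & forall x, iter n.+1 A x = B x].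
Proof.
pose z k := root_iter n.+1 k.
have [Z hZ] := choice (fun x => ip_compl (root_iter_cauchy n x)).
have Zlin : linear Z.
  move=> a x y; apply: (ip_cvg_unique hip ip_def (hZ _)).
  have -> : (fun k => opeval B (z k) (a *: x + y)) =
            (fun k => a *: opeval B (z k) x + opeval B (z k) y).
    by apply/funext => k; rewrite linearP.
  by apply: ip_cvgD => //; exact: ip_cvgZ.
pose A : {linear V -> V} :=
  HB.pack Z (GRing.isLinear.Build R V V *:%R Z Zlin).
have zc k x : ip (opeval B (z k) x) (opeval B (z k) x) <= ip x x.
  by have [h0 h1 _] := root_iter_bounds n k; exact: contraction_le.
exists A; split => /=.
- have le x y : ip (Z x) y <= ip (Z y) x + 0.
    apply: (ip_cvg_le hip (hZ x) (hZ y)) => k.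
    by rewrite addr0 opeval_sym // formC.
  move=> x y; rewrite [RHS](formC hip); apply/le_anti/andP.
  by have := le x y; have := le y x; rewrite !addr0.
- move=> x; have := ip_cvg_le hip (ip_cvg_cst hip 0) (hZ x) (x := x) (y := x) (c := 0).
  rewrite form0l // addr0; apply=> k; rewrite addr0.
  by have [h _ _] := root_iter_bounds n k; exact: h.
- exists 1 => x; rewrite mul1r.
  (* Since [z k] acts as a contraction, [2 <z k x, Z x> <= ||x||^2 + ||Z x||^2]; in the limit this
     gives [||Z x||^2 <= ||x||^2]. *)
  have := ip_cvg_le hip (hZ x) (ip_cvg_cst hip 0) (x := 0) (y := Z x)
    (c := (ip x x + ip (Z x) (Z x)) / 2).
  rewrite form0l // add0r => h; suff : ip (Z x) (Z x) <= (ip x x + ip (Z x) (Z x)) / 2.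
    by lra.
  apply: h => k; have := zc k x.
  by have := form_ge0 hip (opeval B (z k) x - Z x); rewrite formBB //; lra.
- move=> x.
  have hpow j : ip_cvg ip (fun k => opeval B (z k ^+ j) x) (iter j Z x).
    elim: j => [|j IH] /=.
      have -> : (fun k => opeval B (z k ^+ 0) x) = (fun=> x).
        by apply/funext => k; rewrite expr0 opeval1.
      exact: ip_cvg_cst.
    have -> : (fun k => opeval B (z k ^+ j.+1) x) =
              (fun k => opeval B (z k) (opeval B (z k ^+ j) x)).
      by apply/funext => k; rewrite exprS opevalM.
    exact: (ip_cvg_contraction hip (f := fun k => opeval B (z k)) zc IH (hZ _)).
  apply: (ip_cvg_unique hip ip_def (hpow n.+1)).
  (* The recursion solved for its residual: [z_k^(n+1) - B] is a multiple of [z_k - z_(k+1)], which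
     tends strongly to 0. *)
  have e k : z k ^+ n.+1 = n.+1%:R *: (z k + (-1) *: z k.+1) + 'X.
    rewrite /z /= -!mul_polyC; set c := (_^-1)%:P; set w := root_iter _ _.
    have cn : n.+1%:R%:P * c = 1 by rewrite -polyCM mulfV // pnatr_eq0.
    set m := _%:P in cn *; rewrite polyCN polyC1.
    have -> : m * (w + -1 * (w - c * (w ^+ n.+1 - 'X))) =
              m * c * (w ^+ n.+1 - 'X) by ring.
    by rewrite cn; ring.
  have -> : (fun k => opeval B (z k ^+ n.+1) x) =
    (fun k => n.+1%:R *: (opeval B (z k) x + (-1) *: opeval B (z k.+1) x) + B x).
    by apply/funext => k; rewrite e opevalD opevalZ opevalD opevalZ opevalX.
  have := ip_cvgD hip (ip_cvgZ hip n.+1%:R (ip_cvgD hip (hZ x)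
    (ip_cvgZ hip (-1) (ip_cvg_shift (hZ x))))) (ip_cvg_cst hip (B x)).
  by rewrite scaleN1r subrr scaler0 add0r.
Qed.

End Contraction.

Theorem positive_root (B : {linear V -> V}) n :
  opsym ip B -> oppos ip B -> opbounded ip B -> (0 < n)%N ->
  exists A : {linear V -> V},
  [/\ opsym ip A, oppos ip A, opbounded ip A & forall x, iter n A x = B x].
Proof.
case: n => // n Bsym Bpos Bbnd _.
have [c c0 hc] := ppos_ub hip Bbnd 'X.
(* Scaling by [a] reduces to an operator below 1: [B <= c <= a <= a ^+ n.+1], the last because
   [1 <= a]. *)
pose a := c + 1; have a0 : 0 < a by rewrite ltr_wpDl // ltW.
have a1 : 1 <= a by rewrite lerDr ltW.
pose s := (a ^+ n.+1)^-1; have s0 : 0 < s by rewrite invr_gt0 exprn_gt0.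
pose B' : {linear V -> V} := opeval B (s *: 'X).
have B'E x : B' x = s *: B x by rewrite /B' /= opevalZ opevalX.
have [|||x|A [Asym Apos Abnd hA]] := @contraction_root B' _ _ _ _ n.
- exact: opeval_sym.
- exact: opeval_bounded.
- by apply: pposZ => //; [exact: ltW | exact: pposX].
- rewrite opevalB opeval1 opevalX B'E formBl // formZl // subr_ge0.
  rewrite ler_pdivrMl ?exprn_gt0 //.
  have := hc x; rewrite opevalB opevalC opevalX formBl // formZl // subr_ge0.
  move=> h; apply: le_trans h _; rewrite ler_wpM2r ?form_ge0 //.
  by apply: le_trans (_ : a <= _); [rewrite lerDl | rewrite ler_eXnr].
pose A' : {linear V -> V} := opeval A (a *: 'X).
exists A'; split.
- exact: opeval_sym.
- by apply: pposZ => //; [exact: ltW | exact: pposX].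
- exact: opeval_bounded.
- move=> x; suff -> : iter n.+1 A' x = a ^+ n.+1 *: iter n.+1 A x.
    by rewrite hA B'E scalerA mulfV ?scale1r // expf_neq0 // gt_eqF.
  elim: n.+1 => [|k IH]; first by rewrite scale1r.
  by rewrite !iterS IH /A' /= opevalZ opevalX linearZ /= scalerA exprS.
Qed.

End Roots.

(** Let [e] tend to 0; concretely [e = g / (g + |b| + 1)] with [g = x - a > 0] is at most 1 and
    satisfies [e * b < g]. *)
Lemma ler_addeps (R : realType) (x a b : R) :
  (forall e, 0 < e -> e <= 1 -> x <= a + e * b) -> x <= a.
Proof.
move=> h; rewrite leNgt; apply/negP => ax.
pose g := x - a; have g0 : 0 < g by rewrite subr_gt0.
have D0 : 0 < g + `|b| + 1 by rewrite ltr_wpDl // addr_ge0 // ltW.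
have := h (g / (g + `|b| + 1)); rewrite divr_gt0 // ler_pdivrMr // mul1r.
have b0 := normr_ge0 b; have := ler_norm b => bb.
have gg : g <= g + `|b| + 1 by lra.
move=> /(_ isT gg); rewrite -lerBlDl -/g mulrAC ler_pdivlMr //.
by nra.
Qed.

(** * Comparison of a class A operator with the root, and the equality case *)

Section ClassA.
Variables (R : realType) (V : lmodType R) (ip : V -> V -> R).
Hypotheses (hip : psform ip) (ip_def : forall x, ip x x = 0 -> x = 0).
Variables (A S T : {linear V -> V}).
Hypotheses (Asym : opsym ip A) (Abnd : opbounded ip A) (Apos : oppos ip A).
Hypotheses (Ssym : opsym ip S) (Spos : oppos ip S) (Tbnd : opbounded ip T).
Hypothesis S_T2 : forall x, ip (S x) (S x) = ip (T (T x)) (T (T x)).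
Hypothesis T_le_S : forall x, ip (T x) (T x) <= ip (S x) x.
Variable Ts : V -> V.
Hypothesis T_adj : forall x y, ip (T x) y = ip x (Ts y).
Implicit Types (u v : V) (k : nat).

HB.instance Definition _ k :=
  GRing.isLinear.Build R V V *:%R (iter k T) (iter_linear T k).

Let P k u := ip (iter k T u) (iter k T u).
Let Y k u v := ip (S (iter k T u)) (iter k T v).
(** The shift by [eps] bounds these forms below by [eps ^+ k] times the squared norm, so that other
    forms can be measured against them; [a] may have no such bound. *)
Let q (eps : R) k u := ip (opeval A (('X + eps%:P) ^+ k) u) u.
Let a k u := ip (iter k A u) u.

Let T_adj_iter k u v : ip (iter k T u) v = ip u (iter k Ts v).
Proof.
by elim: k v => [|k IH] v //; rewrite iterS T_adj IH -iterSr.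
Qed.

Let P_ge0 k u : 0 <= P k u. Proof. exact: form_ge0. Qed.

Let Y_form k : psform (Y k).
Proof.
split=> [x y z|c x y|x y|x]; rewrite /Y.
- by rewrite !linearD /= formDl.
- by rewrite !linearZ /= formZl.
- by rewrite Ssym formC.
- exact: Spos.
Qed.

Let P_le_Y k u : P k.+1 u <= Y k u u.
Proof. exact: T_le_S. Qed.

Let P2E k u : P k.+2 u = ip (S (iter k T u)) (S (iter k T u)).
Proof. by rewrite S_T2. Qed.

Let Xeps_pos eps : 0 < eps -> ppos ip A ('X + eps%:P).
Proof.
move=> e0; apply: pposD => //; first exact: pposX.
by apply: pposC => //; exact: ltW.
Qed.

Let Xeps_powpos eps k : 0 < eps -> ppos ip A (('X + eps%:P) ^+ k).
Proof. by move=> e0; apply: pposXn => //; exact: Xeps_pos. Qed.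

Let q_ge0 eps k u : 0 < eps -> 0 <= q eps k u.
Proof. by move=> e0; exact: Xeps_powpos. Qed.

Let q_lb eps k u : 0 < eps -> eps ^+ k * ip u u <= q eps k u.
Proof.
move=> e0; rewrite -subr_ge0 /q -formZl // -formBl // -(opevalC A) -opevalB.
elim: k u => [|k IH] u.
  by rewrite !expr0 polyC1 subrr -polyC0 opevalC scale0r form0l.
have -> : ('X + eps%:P) ^+ k.+1 - (eps ^+ k.+1)%:P =
  'X * ('X + eps%:P) ^+ k + eps%:P * (('X + eps%:P) ^+ k - (eps ^+ k)%:P).
  by rewrite !exprS polyCM; ring.
have X0 : ppos ip A 'X by exact: pposX.
apply: pposD => //; first by apply: pposM => //; exact: Xeps_powpos.
by apply: pposM => //; apply: pposC => //; exact: ltW.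
Qed.

Let q_ub eps k : exists2 K, 0 < K & forall u, q eps k u <= K * ip u u.
Proof.
have [K K0 hK] := ppos_ub hip Abnd (('X + eps%:P) ^+ k).
exists K => // u; have := hK u.
by rewrite opevalB opevalC formBl // formZl // subr_ge0.
Qed.

Let a_le_q eps k u : 0 < eps -> a k u <= q eps k u.
Proof.
move=> e0; rewrite -subr_ge0 /a /q -(opevalXn A) -formBl // -opevalB.
elim: k u => [|k IH] u.
  by rewrite !expr0 subrr -polyC0 opevalC scale0r form0l.
have -> : ('X + eps%:P) ^+ k.+1 - 'X^(k.+1) =
  ('X + eps%:P) * (('X + eps%:P) ^+ k - 'X^k) + eps%:P * 'X^k.
  by rewrite !exprS; ring.
apply: pposD => //; first by apply: pposM => //; exact: Xeps_pos.
apply: pposM => //; first by apply: pposC => //; exact: ltW.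
by apply: pposXn => //; exact: pposX.
Qed.

(** [K] is independent of [u] and of [eps] in the range considered, so [eps] can tend to 0
    afterwards. *)
Let q_le_a k : exists K, forall eps, 0 < eps -> eps <= 1 ->
  forall u, q eps k u <= a k u + eps * (K * ip u u).
Proof.
suff [K K0 hK] : exists2 K, 0 <= K & forall eps, 0 < eps -> eps <= 1 ->
    ppos ip A ('X^k + (eps * K)%:P - ('X + eps%:P) ^+ k).
  exists K => eps e0 e1 u; have := hK eps e0 e1 u.
  rewrite opevalB opevalD opevalXn opevalC formBl // formDl // formZl //.
  by rewrite subr_ge0 mulrA.
elim: k => [|k [K K0 IH]].
  by exists 0 => // eps e0 e1; rewrite mulr0 !expr0 addr0 subrr -polyC0; exact: pposC.
have [c c0 hc] := ppos_ub hip Abnd ('X : {poly R}).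
have [d d0 hd] := ppos_ub hip Abnd ('X^k : {poly R}).
have X0 : ppos ip A 'X by exact: pposX.
(* Expanding [('X + eps) ('X^k + eps K)], the constant [c] bounds ['X], [d] bounds ['X^k], and the
   last [K] absorbs [eps^2 K] because [eps <= 1]. *)
exists (K * c + d + K) => [|eps e0 e1].
  by rewrite !addr_ge0 // ?mulr_ge0 // ltW.
have -> : 'X^(k.+1) + (eps * (K * c + d + K))%:P - ('X + eps%:P) ^+ k.+1 =
    ('X + eps%:P) * ('X^k + (eps * K)%:P - ('X + eps%:P) ^+ k)
    + (eps * K)%:P * (c%:P - 'X) + eps%:P * (d%:P - 'X^k)
    + (eps * K * (1 - eps))%:P.
  by rewrite !exprS !(polyCM, polyCD, polyCB, polyC1); ring.
have eK : 0 <= eps * K by rewrite mulr_ge0 // ltW.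
apply: pposD => //; last by apply: pposC => //; rewrite mulr_ge0 // subr_ge0.
apply: pposD => //; last by apply: pposM => //; apply: pposC => //; exact: ltW.
apply: pposD => //; last by apply: pposM => //; exact: pposC.
by apply: pposM; [| | |exact: Xeps_pos|exact: IH].
Qed.

(* Geometric-mean step: [Y k] is the off-diagonal entry of the positive block
   matrix with diagonal [P k], [P k.+2]. *)
Let Y_bound eps k c d : 0 < eps -> eps <= 1 -> 0 <= c -> 0 <= d ->
  (forall u, P k u <= c * q eps k u) ->
  (forall u, P k.+2 u <= d * q eps k.+2 u) ->
  forall u, Y k u u <= Num.sqrt (c * d) * q eps k.+1 u.
Proof.
move=> e0 e1 c0 d0 hc hd.
pose p := 'X + eps%:P.
(* [form_bound] is run with [g] the form of [(A + eps)^(k+1)] and [Q = A + eps]. Then [g u (Q u)]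
   and [q eps k (Q u)] both equal [q eps k.+2 u], which turns Cauchy-Schwarz for [Y k u (Q u)] into
   the required off-diagonal bound. *)
pose g u v := ip (opeval A (p ^+ k.+1) u) v.
pose Q := opeval A p.
have gform : psform g.
  split=> [x y z|t x y|x y|x]; rewrite /g.
  - by rewrite linearD /= formDl.
  - by rewrite linearZ /= formZl.
  - by rewrite opeval_sym // formC.
  - exact: Xeps_powpos.
have gQ u : g u (Q u) = q eps k.+2 u.
  by rewrite /g /Q -opeval_sym // -opevalM -exprS.
have gQQ u : g (Q u) (Q u) = q eps k.+3 u.
  by rewrite /g /Q -opevalM -opeval_sym // -opevalM -exprSr -exprS.
have qQ u : q eps k (Q u) = q eps k.+2 u.
  by rewrite /q /Q -opevalM -opeval_sym // -opevalM -exprSr -exprS.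
have [K0 K00 hK0] := q_ub eps k; have [K1 K10 hK1] := q_ub eps k.+1.
have [K2 K20 hK2] := q_ub eps k.+2; have [K3 K30 hK3] := q_ub eps k.+3.
have K0c := mulr_ge0 c0 (ltW K00); have K2d := mulr_ge0 d0 (ltW K20).
pose K := c * K0 + d * K2 + K1 + K3.
have N0 u : 0 <= ip u u by exact: form_ge0.
have widen L u : L <= K -> L * ip u u <= K * ip u u by move=> ?; exact: ler_wpM2r.
apply: (@form_bound _ _ (Y k) g ip Q (eps ^+ k.+2) K) => //.
- exact: exprn_gt0.
- exact: sqrtr_ge0.
- move=> u; apply: le_trans (_ : (c * K0 + d * K2) * ip u u <= _); last first.
    by apply: widen; rewrite /K; lra.
  have h1 := le_trans (hc u) (ler_wpM2l c0 (hK0 u)).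
  have := le_trans (hd u) (ler_wpM2l d0 (hK2 u)); rewrite P2E.
  have := form_ge0 hip (S (iter k T u) - iter k T u).
  have := P_ge0 k u; have := form_ge0 hip (S (iter k T u)).
  by rewrite formBB // -/(Y k u u) -/(P k u); move: h1; lra.
- move=> u; apply: le_trans (q_lb k.+1 u e0); apply: ler_wpM2r => //.
  by apply: ler_wiXn2l => //; exact: ltW.
- by move=> u; apply: le_trans (hK1 u) _; apply: widen; rewrite /K; lra.
- by move=> u; rewrite gQQ; apply: le_trans (hK3 u) _; apply: widen; rewrite /K; lra.
- by move=> u; rewrite gQ; exact: q_lb.
move=> u; rewrite gQ; have q0 := q_ge0 k.+2 u e0.
have [Y0|Y0] := leP (Y k u (Q u)) 0.
  by apply: le_trans Y0 _; rewrite mulr_ge0 // sqrtr_ge0.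
rewrite -(@ler_pXn2r _ 2%N) ?nnegrE ?mulr_ge0 ?sqrtr_ge0 ?(ltW Y0) //.
rewrite exprMn sqr_sqrtr ?mulr_ge0 //.
apply: le_trans (form_CauchySchwarz hip _ _) _; rewrite -P2E.
have := hc (Q u); rewrite qQ => hc'.
apply: le_trans (ler_pM (P_ge0 _ _) (P_ge0 _ _) (hd u) hc') _.
by rewrite le_eqVlt; apply/orP; left; apply/eqP; ring.
Qed.

Variable N : nat.
Hypothesis P_N : forall u, P N u = a N u.

(** The optimal constants [c j] in [P j <= c j * q eps j] are log-convex by [P_le_Y] and [Y_bound].
    At index 0 both forms are the squared norm, and at [N] one has [P N = a N <= q eps N], so the
    maximum principle applies. *)
Let P_le_q eps k u : 0 < eps -> eps <= 1 -> (k <= N)%N -> P k u <= q eps k u.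
Proof.
move=> e0 e1 kN.
have [M M0 hM] := opbounded_ge0 hip Tbnd.
have PM j v : P j v <= M ^+ j * ip v v.
  elim: j => [|j IH]; first by rewrite mul1r.
  by apply: le_trans (hM _) _; rewrite exprS -mulrA ler_wpM2l.
have /choice[c hc] : forall j, exists mu : R, [/\ 0 <= mu,
    forall u, P j u <= mu * q eps j u &
    forall m, 0 <= m -> (forall u, P j u <= m * q eps j u) -> mu <= m].
  move=> j; apply: (@least_bound _ _ _ _ (M ^+ j / eps ^+ j)) => [v|v||v].
  - exact: P_ge0.
  - exact: q_ge0.
  - by rewrite divr_ge0 ?exprn_ge0 // ltW.
  - apply: le_trans (PM j v) _; rewrite -mulrA ler_wpM2l ?exprn_ge0 //.
    by rewrite ler_pdivlMl ?exprn_gt0 //; exact: q_lb.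
have ck : c k <= 1.
  apply: (@discrete_max_principle _ c N) => [j|||j jN|//].
  - by have [] := hc j.
  - have [_ _ h] := hc 0%N; apply: h => // v.
    by rewrite /q expr0 opeval1 mul1r.
  - have [_ _ h] := hc N; apply: h => // v.
    by rewrite mul1r P_N; exact: a_le_q.
  have [c0 h0 _] := hc j; have [c2 h2 _] := hc j.+2; have [c1 _ h1] := hc j.+1.
  have cc : 0 <= c j * c j.+2 by exact: mulr_ge0.
  rewrite -(sqr_sqrtr cc) ler_pXn2r ?nnegrE ?sqrtr_ge0 //.
  apply: h1; first exact: sqrtr_ge0.
  move=> v; apply: le_trans (P_le_Y _ _) _.
  exact: Y_bound.
have [c0 h _] := hc k; apply: le_trans (h u) _.
by rewrite ler_piMl // q_ge0.
Qed.

Lemma pow_le k u : (k <= N)%N -> P k u <= a k u.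
Proof.
move=> kN; have [K hK] := q_le_a k.
apply: (@ler_addeps _ _ _ (K * ip u u)) => eps e0 e1.
exact: le_trans (P_le_q u e0 e1 kN) (hK _ e0 e1 u).
Qed.

Lemma Y_le k u : (k.+2 <= N)%N -> Y k u u <= a k.+1 u.
Proof.
move=> kN; have [K hK] := q_le_a k.+1.
apply: (@ler_addeps _ _ _ (K * ip u u)) => eps e0 e1.
apply: le_trans (hK _ e0 e1 u).
have := @Y_bound eps k 1 1 e0 e1 ler01 ler01; rewrite mulr1 sqrtr1.
move=> /(_ _ _ u); rewrite mul1r; apply=> v; rewrite mul1r; apply: P_le_q => //.
exact: ltnW (ltnW kN).
Qed.

Let A_form k : psform (fun u v => ip (iter k A u) v).
Proof.
split=> [x y z|c x y|x y|x]; rewrite -!(opevalXn A).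
- by rewrite linearD /= formDl.
- by rewrite linearZ /= formZl.
- by rewrite opeval_sym // formC.
- by apply: pposXn => //; exact: pposX.
Qed.

Let psform_null (b : V -> V -> R) : psform b -> (forall u, b u u = 0) ->
  forall u v, b u v = 0.
Proof.
move=> hb b0 u v; have := form_CauchySchwarz hb u v.
by rewrite b0 mul0r => h; apply/eqP; rewrite -sqrf_eq0 eq_le h sqr_ge0.
Qed.

(** [Y k] is squeezed between [P k.+1] and [a k.+1], hence is the form of [A^(k+1)]. This evaluates
    the cross term in [||S T^k v - T^k A v||^2], and [pow_le] makes the resulting expression
    nonpositive. *)
Lemma rigidity k : (k.+2 <= N)%N -> (forall u, P k.+1 u = a k.+1 u) ->
  (forall v, S (iter k T v) = iter k T (A v)) /\
  ((0 < k)%N -> forall u, P k u = a k u).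
Proof.
move=> kN hP.
have YE u v : Y k u v = ip (iter k.+1 A u) v.
  pose D u v := ip (iter k.+1 A u) v - Y k u v.
  have hD : psform D.
    have hA := A_form k.+1; have hY := Y_form k.
    split=> [x y z|c x y|x y|x]; rewrite /D.
    - by rewrite (formDl hA) (formDl hY); ring.
    - by rewrite (formZl hA) (formZl hY); ring.
    - by rewrite (formC hA) (formC hY).
    - by rewrite subr_ge0; exact: Y_le.
  have D0 w : D w w = 0.
    apply/eqP; rewrite subr_eq0 eq_le -/(a k.+1 w) -hP P_le_Y hP.
    exact: Y_le.
  by apply/esym/eqP; rewrite -subr_eq0; apply/eqP; exact: (psform_null hD D0 u v).
have aA v : a k (A v) = a k.+2 v.
  by rewrite /a -iterSr -Asym.
have key v : ip (S (iter k T v) - iter k T (A v)) (S (iter k T v) - iter k T (A v)) =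
    P k.+2 v - 2 * a k.+2 v + P k (A v).
  rewrite formBB // -P2E -/(Y k v (A v)) YE -/(P k (A v)).
  by rewrite -Asym.
have le1 v := pow_le v kN; have le2 v := pow_le v (ltnW (ltnW kN)).
split=> [v|k0 u].
  apply/eqP; rewrite -subr_eq0; apply/eqP; apply: ip_def; apply/eqP; rewrite eq_le.
  rewrite form_ge0 // andbT key; have := le1 v; have := le2 (A v).
  by rewrite aA; lra.
pose D u v := ip (iter k A u) v - ip (iter k T u) (iter k T v).
have hD : psform D.
  have hA := A_form k; split=> [x y z|c x y|x y|x]; rewrite /D.
  - by rewrite (formDl hA) linearD /= formDl //; ring.
  - by rewrite (formZl hA) linearZ /= formZl //; ring.
  - by rewrite (formC hA) (formC hip (iter k T x)).
  - by rewrite subr_ge0; exact: le2.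
(* The expansion in [key] is nonnegative and [P k.+2 v <= a k.+2 v], so [P k (A v)] is at least
   [a k (A v)]: equality holds on the range of [A]. *)
have DA v : D (A v) (A v) = 0.
  rewrite /D -/(a k (A v)) -/(P k (A v)); have := le1 v; have := le2 (A v).
  have := form_ge0 hip (S (iter k T v) - iter k T (A v)); rewrite key aA; lra.
have DA0 v w : D (A v) w = 0.
  have := form_CauchySchwarz hD (A v) w.
  by rewrite DA mul0r => h; apply/eqP; rewrite -sqrf_eq0 eq_le h sqr_ge0.
(* [w] represents the functional [D u], so proving [w = 0] extends the equality from the range of
   [A] to every vector. *)
pose w := iter k A u - iter k Ts (iter k T u).
have wE y : D u y = ip y w.
  rewrite /D (formC hip y) formBl // [ip (iter k T u) _](formC hip).
  by rewrite T_adj_iter [ip y _](formC hip).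
have Aw : A w = 0.
  by apply: ip_def; rewrite Asym formC // -wE (formC hD) DA0.
have Dww : D w w = 0.
  (* Positivity of [k] turns [A w = 0] into [A^k w = 0]; hence [D w w = - P k w <= 0]. *)
  have A0 : iter k A w = 0.
    by rewrite -(prednK k0) iterSr Aw -(opevalXn A) linear0.
  apply/eqP; rewrite eq_le (form_ge0 hD) andbT /D A0.
  by rewrite form0l // sub0r oppr_le0 form_ge0.
have w0 : w = 0.
  apply: ip_def; rewrite -wE; have := form_CauchySchwarz hD u w.
  by rewrite Dww mulr0 => h; apply/eqP; rewrite -sqrf_eq0 eq_le h sqr_ge0.
have := wE u; rewrite w0 formC // form0l // => /eqP.
by rewrite subr_eq0 => /eqP.
Qed.

(** [n < N] keeps the whole descent from [n] within reach of [rigidity], and [1 < n] brings exponent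
    2 into it, from which level 1 yields the commutation. *)
Lemma pow_eq_quasinormal n : (1 < n)%N -> (n < N)%N ->
  (forall u, P n u = a n u) ->
  (forall u v, ip (T u) (T v) = ip (A u) v) /\ (forall v, A (T v) = T (A v)).
Proof.
move=> n1 nN hn.
have down j : (j < n)%N -> forall u, P (n - j) u = a (n - j) u.
  elim: j => [|j IH] jn; first by rewrite subn0.
  have e : (n - j)%N = (n - j.+1).+1 by rewrite subnSK // ltnW.
  have := IH (ltnW jn); rewrite e => /rigidity[|_]; last by apply; rewrite subn_gt0.
  by rewrite -e; apply: leq_ltn_trans nN; exact: leq_subr.
have P1 u : P 1 u = a 1 u.
  have := down n.-1; rewrite prednK ?(ltnW n1) // => /(_ (leqnn _)).
  by rewrite -subn1 subKn // ltnW.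
have P2 u : P 2 u = a 2 u.
  have := down (n - 2)%N; rewrite subKn // => -> //.
  by rewrite ltn_subrL // (ltnW n1).
have [SA _] := rigidity (k := 0) (leq_ltn_trans (ltnW n1) nN) P1.
have [ST _] := rigidity (k := 1) (leq_ltn_trans n1 nN) P2.
split=> [u v|v]; last by have := ST v; rewrite (SA (T v)).
have h x : ip (T x) (T x) = ip (A x) x by exact: P1.
have := h (u + v); rewrite !linearD /= formDD // formDl // !formDr // !h.
by rewrite [ip (A v) u]Asym [ip v (A u)](formC hip); lra.
Qed.

End ClassA.

(** * The real Hilbert space underlying a complex one *)

Definition realified (R : realType) (V : lmodType R[i]) : Type := V.

Section Realification.
Variables (R : realType) (V : lmodType R[i]).

HB.instance Definition _ := GRing.Zmodule.copy (realified V) V.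

(** The separate carrier name [realified V] lets the real scalar action coexist with the complex one
    on [V]. *)
Definition realified_scale (r : R) (x : realified V) : realified V :=
  (r%:C)%C *: (x : V).

Fact realified_scaleA r s x :
  realified_scale r (realified_scale s x) = realified_scale (r * s) x.
Proof. by rewrite /realified_scale scalerA -rmorphM. Qed.

Fact realified_scale1 : left_id 1 realified_scale.
Proof. by move=> x; rewrite /realified_scale rmorph1 scale1r. Qed.

Fact realified_scaleDr : right_distributive realified_scale +%R.
Proof. by move=> r x y; exact: scalerDr. Qed.

Fact realified_scaleDl x : {morph realified_scale^~ x : r s / r + s}.
Proof. by move=> r s; rewrite /realified_scale rmorphD; exact: scalerDl. Qed.

HB.instance Definition _ := GRing.Zmodule_isLmodule.Build R (realified V)
  realified_scaleA realified_scale1 realified_scaleDr realified_scaleDl.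

Variable ip : V -> V -> R[i].
Hypothesis hip : is_inner_product ip.

Definition real_ip (x y : realified V) : R := complex.Re (ip x y).

Lemma Re_ge0 (z : R[i]) : 0 <= z -> 0 <= complex.Re z.
Proof. by rewrite lecE => /andP[_]. Qed.

Lemma Re_le (z w : R[i]) : z <= w -> complex.Re z <= complex.Re w.
Proof. by rewrite lecE => /andP[_]. Qed.

Lemma real_ip_psform : psform real_ip.
Proof.
have [hlin hC h0 _] := hip; split=> [x y z|c x y|x y|x]; rewrite /real_ip.
- by have := hlin 1 x y z; rewrite scale1r mul1r => ->; rewrite raddfD.
- have ip0 : ip 0 y = 0.
    have := hlin 1 0 0 y; rewrite scale1r mul1r addr0 => h.
    by apply: (addIr (ip 0 y)); rewrite add0r -h.
  have := hlin (c%:C)%C x 0 y; rewrite addr0 ip0 addr0 => ->.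
  by case: (ip x y) => a b /=; rewrite mul0r subr0.
- by rewrite hC; case: (ip y x).
- exact: Re_ge0.
Qed.

(** Being nonnegative in [R[i]] includes having zero imaginary part. The real and complex norms
    therefore agree, so completeness and boundedness transfer. *)
Lemma ip_selfE x : ip x x = ((real_ip x x)%:C)%C.
Proof.
have [_ _ h0 _] := hip; have := h0 x; rewrite lecE /= => /andP[/eqP im0 _].
by rewrite /real_ip; move: im0; case: (ip x x) => r i /= ->.
Qed.

Lemma real_ip_def x : real_ip x x = 0 -> x = 0.
Proof. by have [_ _ _ hd] := hip; move=> h; apply: hd; rewrite ip_selfE h. Qed.

Lemma real_ip_complete : ip_complete ip ->
  forall u : nat -> realified V, ip_cauchy real_ip u ->
  exists l, ip_cvg real_ip u l.
Proof.
move=> hcomp u hu; have [e|l hl] := hcomp u.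
  rewrite ltcE /= => /andP[/eqP ime /hu[N hN]]; exists N => m p Nm Np.
  by rewrite ip_selfE ltcE /= ime eqxx; exact: hN.
exists l => e e0; have [|N hN] := hl (e%:C)%C; first by rewrite ltcR.
by exists N => m /hN; rewrite ip_selfE ltcR.
Qed.

Lemma realified_linear (T : V -> V) : bounded_op ip T ->
  linear (T : realified V -> realified V).
Proof. by move=> [hD hZ _] c x y; rewrite hD hZ. Qed.

Lemma real_ip_bounded (T : V -> V) : bounded_op ip T -> opbounded real_ip T.
Proof.
move=> [_ _ [M hM]]; exists (complex.Re M) => x; have := Re_le (hM x).
by rewrite [ip x x]ip_selfE; case: M {hM} => a b /=; rewrite mulr0 subr0.
Qed.

End Realification.

(* X = T^n, X^* = (T^* )^n; powers of operators are iterated compositions. *)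
Theorem theorem4p3 (R : realType) (V : lmodType R[i]) (ip : V -> V -> R[i])
    (hH : is_hilbert_space ip)
    (T Ts : V -> V) (hT : bounded_op ip T) (hTs : is_adjoint ip T Ts)
    (hA : class_A ip T Ts)
    (n kappa : nat) (hn : (1 < n)%N) (hk : (1 < kappa)%N)
    (hX : forall x : V,
        iter kappa (iter n Ts) (iter kappa (iter n T) x)
        = iter kappa (fun y => iter n Ts (iter n T y)) x) :
  quasinormal T Ts.
Proof.
have [hip hcomp] := hH; have [S [[Sbnd Sadj Spos S2] TS]] := hA.
pose W : lmodType R := realified V; pose rip : W -> W -> R := real_ip ip.
have hr : psform rip by exact: real_ip_psform.
have hd (x : W) : rip x x = 0 -> x = 0 by exact: real_ip_def.
pose T' : {linear W -> W} :=
  HB.pack (T : W -> W) (GRing.isLinear.Build R W W *:%R T (realified_linear hT)).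
pose S' : {linear W -> W} :=
  HB.pack (S : W -> W) (GRing.isLinear.Build R W W *:%R S (realified_linear Sbnd)).
have Tbnd : opbounded rip T' := real_ip_bounded hip hT.
have adj (x y : W) : rip (T x) y = rip x (Ts y) by rewrite /rip /real_ip hTs.
have adjn m (x y : W) : rip (iter m T x) y = rip x (iter m Ts y).
  by elim: m y => [|m IH] y //; rewrite iterS adj IH -iterSr.
have adjnC m (x y : W) : rip (iter m Ts x) y = rip x (iter m T y).
  by rewrite (formC hr) -adjn (formC hr).
have inj (x y : W) : (forall z, rip z x = rip z y) -> x = y.
  move=> h; apply/eqP; rewrite -subr_eq0; apply/eqP/hd.
  by rewrite (formBr hr); apply/eqP; rewrite subr_eq0; apply/eqP.
pose Bf (x : W) : W := iter n Ts (iter n T x).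
have Tn_lin := iter_linear T' n.
(* [Ts] is a bare function characterised by adjointness, so linearity is checked by pairing with an
   arbitrary [z]. *)
have Blin : linear Bf.
  move=> c x y; apply: inj => z.
  rewrite (formDr hr) (formZr hr) /Bf -!adjn Tn_lin.
  by rewrite (formDr hr) (formZr hr).
pose B : {linear W -> W} := HB.pack Bf (GRing.isLinear.Build R W W *:%R Bf Blin).
have Bsym : opsym rip B by move=> x y; rewrite /= /Bf adjnC -adjn.
have Bpos : oppos rip B by move=> x; rewrite /= /Bf adjnC; exact: form_ge0 hr _.
(* Only [T] comes with a bound. With [b = ||B x||^2 = <T^n x, T^n B x>], Cauchy-Schwarz gives
   [b^2 <= M^(2n) ||x||^2 b], and a positive [b] cancels. *)
have Bbnd : opbounded rip B.
  have [M M0 hM] := opbounded_ge0 hr Tbnd.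
  have hMn m (x : W) : rip (iter m T x) (iter m T x) <= M ^+ m * rip x x.
    elim: m => [|m IH]; first by rewrite mul1r.
    by apply: le_trans (hM _) _; rewrite exprS -mulrA ler_wpM2l.
  exists (M ^+ n * M ^+ n) => x.
  set b := rip (B x) (B x).
  have [b0|b0] := leP b 0.
    apply: le_trans b0 _; rewrite mulr_ge0 ?(form_ge0 hr) //.
    by rewrite mulr_ge0 // exprn_ge0.
  rewrite -(ler_pM2l b0) -expr2.
  have -> : b = rip (iter n T x) (iter n T (B x)).
    by rewrite /b {1}/B /= /Bf adjnC.
  apply: le_trans (form_CauchySchwarz hr _ _) _.
  have -> : rip (iter n T x) (iter n T (B x)) = b by rewrite /b {2}/B /= /Bf adjnC.
  have p0 := form_ge0 hr (iter n T x); have p1 := form_ge0 hr (iter n T (B x)).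
  apply: le_trans (ler_pM p0 p1 (hMn n x) (hMn n (B x))) _.
  by rewrite -/b le_eqVlt; apply/orP; left; apply/eqP; ring.
have [A [Asym Apos Abnd hAn]] :=
  positive_root hr hd (real_ip_complete hip hcomp) Bsym Bpos Bbnd (ltnW hn).
have iter_iter (f : W -> W) (x : W) : iter kappa (iter n f) x = iter (kappa * n) f x.
  by elim: kappa {hk hX} => [|m IH] //; rewrite mulSn iterD -IH.
have Ssym : opsym rip S' by move=> x y; rewrite /rip /real_ip /= Sadj.
have S'pos : oppos rip S' by move=> x; exact: Re_ge0.
have ST2 (x : W) : rip (S' x) (S' x) = rip (T' (T' x)) (T' (T' x)).
  by rewrite Ssym /= S2 -!adj.
have TleS (x : W) : rip (T' x) (T' x) <= rip (S' x) x.
  rewrite /= adj (formC hr) -subr_ge0 -(formBl hr).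
  by apply: Re_ge0; exact: TS.
have Pn (x : W) : rip (iter n T' x) (iter n T' x) = rip (iter n A x) x.
  by rewrite hAn /= /Bf adjnC.
(* The hypothesis on [X = T^n] enters here: it supplies the equality at the upper end
   [N = kappa * n] of the comparison. *)
have PN (x : W) : rip (iter (kappa * n) T' x) (iter (kappa * n) T' x) =
    rip (iter (kappa * n) A x) x.
  rewrite adjn -!iter_iter (hX x) (formC hr).
  by congr (rip (iter kappa _ x) x); apply/funext => y; rewrite hAn.
(* [1 < kappa] makes [n] an interior index, as the equality case requires. *)
have nN : (n < kappa * n)%N by rewrite ltn_Pmull // ltnW.
have [TT AT] := pow_eq_quasinormal hr hd Asym Abnd Apos Ssym S'pos Tbnd ST2 TleS
  adj PN hn nN Pn.
have AE (x : W) : A x = Ts (T x).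
  by apply: inj => z; rewrite -adj TT Asym.
by move=> x; have := AT x; rewrite !AE.
Qed.
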